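(* For every (real) Banach space $Z$ with an unconditional subsymmetric basis $(z_n)_{n\in\mathbb{N}}$ there exists a Banach space $X$ with a Schauder basis $(e_n)_{n\in\mathbb{N}}$ such that $Z^*$ is isomorphic to a complemented subspace of $\mathcal{L}_{\mathrm{diag}}(X)$.
   Context: $\mathcal{L}_{\mathrm{diag}}(X)$ denotes the space, with the operator norm, of all bounded linear operators $T:X\to X$ which are diagonal with respect to the basis $(e_n)$, i.e. for which there is a scalar sequence $(\lambda_n)_{n}$ with $Te_n=\lambda_ne_n$ for all $n$. An unconditional basis is subsymmetric if it is equivalent to each of its subsequences. *)

(* Defs.v *)
From HB Require Import structures.
From mathcomp Require Import all_boot all_order all_algebra.
From mathcomp Require Import all_classical all_reals all_analysis.

Set Implicit Arguments.
Unset Strict Implicit.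
Unset Printing Implicit Defensive.

Import Order.TTheory GRing.Theory Num.Theory.
Import numFieldNormedType.Exports.

Local Open Scope classical_set_scope.
Local Open Scope ring_scope.

Section BoundedOperators.
Variables (R : realType) (U V : normedModType R).
Implicit Types (f g : U -> V).

Definition bounded_linear f : Prop :=
  linear f /\ exists M : R, forall x, `|f x| <= M * `|x|.

Definition bop_pred : {pred U -> V} := mem [set f | bounded_linear f].

Lemma bop_submod_closed : submod_closed bop_pred.
Proof.
split=> [|a f g].
  rewrite inE; split=> [c x y /=|]; first by rewrite scaler0 addr0.
  by exists 0 => x; rewrite mul0r normr0.
rewrite !inE => -[lf [M fM]] [lg [N gN]]; split=> [c x y /=|].
  rewrite !fctE lf lg !scalerDr !scalerA (mulrC a c).
  by rewrite -!addrA; congr (_ + _); rewrite addrCA.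
exists (`|a| * M + N) => x; rewrite !fctE mulrDl.
rewrite (le_trans (ler_normD _ _))// lerD// normrZ -mulrA.
by rewrite ler_wpM2l.
Qed.

HB.instance Definition _ :=
  GRing.isSubmodClosed.Build R (U -> V) bop_pred bop_submod_closed.

Record bop := Bop { bop_fun :> U -> V; bop_in : bop_fun \in bop_pred }.

HB.instance Definition _ := [isSub for bop_fun].
HB.instance Definition _ := [Choice of bop by <:].
HB.instance Definition _ := [SubChoice_isSubLmodule of bop by <:].

Lemma bopP (T : bop) : bounded_linear T.
Proof. by have := bop_in T; rewrite inE. Qed.

Lemma bop_eqP (S T : bop) : S =1 T -> S = T.
Proof. by move=> ST; apply: val_inj; apply: funext. Qed.

Lemma bopD (S T : bop) x : (S + T) x = S x + T x.
Proof. by []. Qed.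

Lemma bopZ (a : R) (T : bop) x : (a *: T) x = a *: T x.
Proof. by []. Qed.

HB.instance Definition _ (T : bop) :=
  GRing.isLinear.Build R U V *:%R T (bopP T).1.

Definition opnorm (T : bop) : R := sup [set `|T x| | x in [set x | `|x| <= 1]].

Lemma opnorm_has_sup (T : bop) : has_sup [set `|T x| | x in [set x | `|x| <= 1]].
Proof.
split; first by exists `|T 0|, 0 => //=; rewrite normr0.
have [_ [M TM]] := bopP T; exists `|M| => _ [x /= x1 <-].
rewrite (le_trans (TM x))// (le_trans (ler_norm _))// normrM normr_id.
by rewrite ler_piMr.
Qed.

Lemma opnorm_ub (T : bop) x : `|x| <= 1 -> `|T x| <= opnorm T.
Proof.
by move=> x1; apply: sup_upper_bound; [exact: opnorm_has_sup|exists x].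
Qed.

Lemma opnorm_ge0 (T : bop) : 0 <= opnorm T.
Proof. by apply: le_trans (opnorm_ub T (x := 0) _); rewrite ?normr0. Qed.

Lemma opnorm_le_unit (T : bop) (M : R) :
  (forall x, `|x| <= 1 -> `|T x| <= M) -> opnorm T <= M.
Proof.
move=> TM; apply: ge_sup; first exact: (opnorm_has_sup T).1.
by move=> _ [x /= x1 <-]; exact: TM.
Qed.

Lemma opnorm_bound (T : bop) x : `|T x| <= opnorm T * `|x|.
Proof.
have [->|x0] := eqVneq x 0; first by rewrite linear0 !normr0 mulr0.
have nx : 0 < `|x| by rewrite normr_gt0.
rewrite -ler_pdivrMr// mulrC.
have -> : `|x|^-1 * `|T x| = `|T (`|x|^-1 *: x)|.
  by rewrite linearZ normrZ normfV normr_id.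
by apply: opnorm_ub; rewrite normrZ normfV normr_id mulVf// gt_eqF.
Qed.

Lemma opnormD (S T : bop) : opnorm (S + T) <= opnorm S + opnorm T.
Proof.
apply: opnorm_le_unit => x x1; rewrite bopD (le_trans (ler_normD _ _))//.
by rewrite lerD// opnorm_ub.
Qed.

Lemma opnormZ_le (a : R) (T : bop) : opnorm (a *: T) <= `|a| * opnorm T.
Proof.
by apply: opnorm_le_unit => x x1; rewrite bopZ normrZ ler_wpM2l// opnorm_ub.
Qed.

Lemma opnormZ (a : R) (T : bop) : opnorm (a *: T) = `|a| * opnorm T.
Proof.
apply/eqP; rewrite eq_le opnormZ_le /=.
have [->|a0] := eqVneq a 0; first by rewrite normr0 mul0r opnorm_ge0.
have na : 0 < `|a| by rewrite normr_gt0.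
rewrite mulrC -ler_pdivlMr// mulrC -normfV.
by apply: le_trans (opnormZ_le _ _); rewrite scalerA mulVf// scale1r.
Qed.

Lemma opnorm0_eq0 (T : bop) : opnorm T = 0 -> T = 0.
Proof.
move=> T0; apply: bop_eqP => x; apply/eqP; rewrite -normr_eq0.
by have := opnorm_bound T x; rewrite T0 mul0r => Tx; rewrite eq_le Tx /=.
Qed.

HB.instance Definition _ :=
  @Lmodule_isNormed.Build R bop opnorm opnormD opnormZ opnorm0_eq0.

Lemma bop_normE (T : bop) : `|T| = opnorm T.
Proof. by []. Qed.

End BoundedOperators.

Definition dual_space (R : realType) (U : normedModType R) : normedModType R :=
  bop U R.

Section Bases.
Variables (R : realType) (U : normedModType R).
Implicit Types (e f : nat -> U).

Definition schauder_basis e : Prop :=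
  forall x : U, exists! a : nat -> R,
    series (fun n => a n *: e n) @ \oo --> x.

Definition unconditionally_cvg (u : nat -> U) : Prop :=
  forall s : nat -> nat, bijective s -> cvgn (series (u \o s)).

Definition unconditional_basis e : Prop :=
  schauder_basis e /\
  forall a : nat -> R, cvgn (series (fun n => a n *: e n)) ->
    unconditionally_cvg (fun n => a n *: e n).

Definition equivalent_seq e f : Prop :=
  forall a : nat -> R,
    cvgn (series (fun n => a n *: e n)) <-> cvgn (series (fun n => a n *: f n)).

Definition subsymmetric_basis e : Prop :=
  unconditional_basis e /\
  forall s : nat -> nat, {homo s : m n / (m < n)%N} -> equivalent_seq e (e \o s).

End Bases.

Section Diagonal.
Variables (R : realType) (X : normedModType R) (e : nat -> X).

Definition is_diagonal (T : bop X X) : Prop :=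
  exists l : nat -> R, forall n, T (e n) = l n *: e n.

Definition ldiag_pred : {pred bop X X} := mem [set T | is_diagonal T].

Lemma ldiag_submod_closed : submod_closed ldiag_pred.
Proof.
split=> [|a S T].
  by rewrite inE; exists (fun=> 0) => n; rewrite scale0r.
rewrite !inE => -[l Sl] [m Tm]; exists (fun n => a * l n + m n) => n.
by rewrite bopD bopZ Sl Tm scalerA scalerDl.
Qed.

HB.instance Definition _ :=
  GRing.isSubmodClosed.Build R (bop X X) ldiag_pred ldiag_submod_closed.

Record ldiag := Ldiag { ldiag_op :> bop X X; ldiag_in : ldiag_op \in ldiag_pred }.

HB.instance Definition _ := [isSub for ldiag_op].
HB.instance Definition _ := [Choice of ldiag by <:].
HB.instance Definition _ := [SubChoice_isSubLmodule of ldiag by <:].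

Lemma ldiagP (T : ldiag) : is_diagonal T.
Proof. by have := ldiag_in T; rewrite inE. Qed.

Definition ldiag_norm (T : ldiag) : R := `|ldiag_op T|.

Lemma ldiag_normD (S T : ldiag) :
  ldiag_norm (S + T) <= ldiag_norm S + ldiag_norm T.
Proof. exact: ler_normD. Qed.

Lemma ldiag_normZ (a : R) (T : ldiag) :
  ldiag_norm (a *: T) = `|a| * ldiag_norm T.
Proof. exact: normrZ. Qed.

Lemma ldiag_norm0_eq0 (T : ldiag) : ldiag_norm T = 0 -> T = 0.
Proof. by move=> /normr0_eq0 T0; apply: val_inj. Qed.

HB.instance Definition _ :=
  @Lmodule_isNormed.Build R ldiag ldiag_norm
    ldiag_normD ldiag_normZ ldiag_norm0_eq0.

Lemma ldiag_normE (T : ldiag) : `|T| = `|ldiag_op T|.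
Proof. by []. Qed.

End Diagonal.

Section Subspaces.
Variables (R : realType) (V W : normedModType R).

(* The range of a bounded linear map is a linear subspace, and the range of a
   bounded projection is closed, so neither property is required separately. *)
Definition complemented (Y : set W) : Prop :=
  exists P : bop W W, (forall w, P (P w) = P w) /\ range P = Y.

(* [S] is the inverse isomorphism; its values outside [Y] are irrelevant. *)
Definition isomorphic_onto (Y : set W) : Prop :=
  exists (T : bop V W) (S : W -> V),
    [/\ range T = Y, cancel T S & {within Y, continuous S}].

Definition isomorphic_to_complemented_subspace : Prop :=
  exists Y : set W, complemented Y /\ isomorphic_onto Y.

End Subspaces.
Arguments isomorphic_to_complemented_subspace {R} V W.

(* Main.v *)
From HB Require Import structures.
Require Import Defs.
From mathcomp Require Import all_boot all_order all_algebra.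
From mathcomp Require Import all_classical all_reals all_analysis.
From mathcomp Require Import ring lra zify.

(* Let cs be the space of convergent scalar series, normed by the supremum of
   the partial sums, with unit vectors s_n. Take X = cs (+) Z with the basis
   (s_0, 0), (s_0, z_0/|z_0|), (s_1, 0), (s_1, z_1/|z_1|), ... A functional f
   on Z gives the diagonal operator with eigenvalues 0 on (s_n, 0) and
   f(z_n)/|z_n| on (s_n, z_n/|z_n|): it sends (c, x) to the pair of the
   sequence (f(z_n) x_n)_n and the vector sum_n (f(z_n)/|z_n|) x_n z_n, where
   x = sum_n x_n z_n. Since sum_n f(z_n) x_n = f(x), a bounded left inverse of
   this embedding sends a diagonal operator T to the functional
   x |-> sum of the series T(0, x).1.

   The embedding is bounded because the seminorm
   p(x) = sup over N and |th_n| <= 1 of |sum_(n < N) th_n x_n z_n| is finite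
   and bounded by a multiple of the norm: it is countably subadditive, so
   Zabreiko's lemma (a consequence of Baire's theorem) applies. *)

Set Implicit Arguments.
Unset Strict Implicit.
Unset Printing Implicit Defensive.

Import Order.TTheory GRing.Theory Num.Theory.
Import numFieldNormedType.Exports.

Local Open Scope classical_set_scope.
Local Open Scope ring_scope.

(** * Permutations of the natural numbers assembled from finite blocks *)

Section BlockPermutation.
Variable L : nat -> seq nat.
Hypothesis L_gt0 : forall N, (0 < size (L N))%N.
Hypothesis L_perm : forall N, perm_eq (L N) (iota N (size (L N))).

(** Each new block [L N] starts at the length [N] reached so far, so that every stage is a
    rearrangement of an initial segment. *)
Fixpoint blocks k : seq nat :=
  if k is k'.+1 then blocks k' ++ L (size (blocks k')) else [::].

Lemma leq_size_blocks k : (k <= size (blocks k))%N.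
Proof.
by elim: k => //= k IH; rewrite size_cat; have := L_gt0 (size (blocks k)); lia.
Qed.

Lemma perm_blocks k : perm_eq (blocks k) (iota 0 (size (blocks k))).
Proof.
by elim: k => //= k IH; rewrite size_cat iotaD add0n perm_cat.
Qed.

Lemma mem_blocks k n : (n \in blocks k) = (n < size (blocks k))%N.
Proof. by rewrite (perm_mem (perm_blocks k)) mem_iota. Qed.

Lemma uniq_blocks k : uniq (blocks k).
Proof. by rewrite (perm_uniq (perm_blocks k)) iota_uniq. Qed.

Lemma prefix_blocks k k' : (k <= k')%N -> prefix (blocks k) (blocks k').
Proof.
move=> /subnK <-; elim: (k' - k)%N => [|d IH]; first exact: prefix_refl.
by rewrite addSn /=; exact: prefix_trans IH (prefix_prefix _ _).
Qed.

Lemma nth_blocks k k' n : (k <= k')%N -> (n < size (blocks k))%N ->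
  nth 0%N (blocks k') n = nth 0%N (blocks k) n.
Proof. by move=> /prefix_blocks/prefixP[t ->] nk; rewrite nth_cat nk. Qed.

(** Stages extend one another, and stage [n.+1] has more than [n] entries because no block is empty;
    later stages give the same value. *)
Definition block_perm n := nth 0%N (blocks n.+1) n.

Lemma block_permE k n : (n < size (blocks k))%N ->
  block_perm n = nth 0%N (blocks k) n.
Proof.
move=> nk; have [kn|nk'] := leqP k n.+1; first exact: nth_blocks.
by rewrite /block_perm -(@nth_blocks n.+1 k)// ?leq_size_blocks// ltnW.
Qed.

Lemma block_perm_bij : bijective block_perm.
Proof.
exists (fun m => index m (blocks m.+1)) => [n|m].
  (* Stage [k] is long enough for both [n] and its image. It has no repetition and extends the stage
     in which the inverse searches, so both searches find the same index. *)
  pose k := (maxn n (block_perm n)).+1.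
  have nk : (n < size (blocks k))%N.
    by apply: leq_trans (leq_size_blocks k); rewrite ltnS leq_maxl.
  have eqn := block_permE nk.
  have bk : ((block_perm n).+1 <= k)%N by rewrite ltnS leq_maxr.
  have /prefixP[t kt] := prefix_blocks bk.
  rewrite -[RHS](index_uniq 0%N nk (uniq_blocks k)) -eqn kt index_cat.
  by rewrite mem_blocks leq_size_blocks.
have mm : m \in blocks m.+1 by rewrite mem_blocks leq_size_blocks.
by rewrite (@block_permE m.+1) ?index_mem// nth_index.
Qed.

Lemma map_block_perm k : let N := size (blocks k) in
  map block_perm (iota N (size (L N))) = L N.
Proof.
move=> N; apply: (@eq_from_nth _ 0%N) => [|i]; rewrite size_map size_iota// => iL.
rewrite (nth_map 0%N) ?size_iota// nth_iota//.
rewrite (@block_permE k.+1) /= ?size_cat ?ltn_add2l//.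
by rewrite nth_cat -/N ltnNge leq_addr/= addKn.
Qed.

End BlockPermutation.

(** * Unconditional convergence: subset sums and bounded multipliers *)

Section Sums.
Variables (R : realType) (V : normedModType R).
Implicit Types (u : nat -> V) (G : pred nat) (v : V) (M : R).

Lemma uncond_subset_tail u : unconditionally_cvg u -> forall e : R, 0 < e ->
  exists N, forall m n G, (N <= m)%N -> `|\sum_(m <= i < n | G i) u i| < e.
Proof.
(* Otherwise N is split into consecutive blocks each containing a set of large
   sum; listing that set first in every block gives a divergent rearrangement. *)
move=> uu e e0; apply: contrapT => /forallNP bad.
have {}bad N : exists t : nat * nat * pred nat, (N <= t.1.1)%N /\
    e <= `|\sum_(t.1.1 <= i < t.1.2 | t.2 i) u i|.
  have /existsNP[m /existsNP[n /existsNP[G /not_implyP[Nm /negP]]]] := bad N.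
  by rewrite -leNgt => ?; exists (m, n, G).
have [t {}bad] := choice bad.
pose A N := [seq i <- index_iota N (t N).1.2 | ((t N).1.1 <= i)%N && (t N).2 i].
pose B N := [seq i <- index_iota N (t N).1.2 | ~~ (((t N).1.1 <= i)%N && (t N).2 i)].
have AE N : \sum_(i <- A N) u i = \sum_((t N).1.1 <= i < (t N).1.2 | (t N).2 i) u i.
  rewrite [RHS](big_nat_widenl _ N); last exact: (bad N).1.
  by rewrite big_filter; apply: eq_bigl => i; rewrite andbC.
(* A set with sum of norm at least [e] is nonempty, hence so is every block, as [block_perm]
   requires. *)
have A0 N : (0 < size (A N))%N.
  rewrite lt0n; apply/negP => /nilP A0.
  by have := (bad N).2; rewrite -AE A0 big_nil normr0 leNgt e0.
pose L N := A N ++ B N.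
have Lperm N : perm_eq (L N) (index_iota N (t N).1.2) by rewrite perm_filterC.
have L_size N : size (L N) = ((t N).1.2 - N)%N.
  by rewrite (perm_size (Lperm N)) size_iota.
have L_gt0 N : (0 < size (L N))%N by rewrite size_cat; have := A0 N; lia.
have L_perm N : perm_eq (L N) (iota N (size (L N))) by rewrite L_size.
have /uu/cvg_cauchy/cauchy_seriesP/(_ e e0) := block_perm_bij L_gt0 L_perm.
case=> -[P Q] /= [[a _ Pa] [b _ Qb]] PQ.
(* [N] starts a block beyond both Cauchy thresholds; the rearrangement lists exactly [A N] on the
   next [size (A N)] positions, where its sum has norm at least [e]. *)
pose N := size (blocks L (maxn a b)).
have Nab : (maxn a b <= N)%N by exact: leq_size_blocks.
have := PQ (N, (N + size (A N))%N); rewrite /= => /(_ _)/wrap[].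
  by split; [apply: Pa => /=|apply: Qb => /=]; lia.
apply/negP; rewrite -leNgt.
have := map_block_perm L_gt0 (maxn a b); rewrite -/N => mapL.
suff -> : \sum_(N <= k < N + size (A N)) (u \o block_perm L) k = \sum_(i <- A N) u i.
  by rewrite AE; exact: (bad N).2.
rewrite -(big_map (block_perm L) xpredT u) /index_iota addKn.
congr (\sum_(i <- _) _).
have /(congr1 (take (size (A N)))) := mapL.
by rewrite take_size_cat// -map_take take_iota /L size_cat (minn_idPl _)// leq_addr.
Qed.

(* A point of the cube is an average of two points of the cube with one
   coordinate moved to 0 and to 1 respectively. *)
Lemma norm_sum_cube u (r : seq nat) v M (th : nat -> R) : uniq r ->
  (forall G, `|v + \sum_(i <- r | G i) u i| <= M) ->
  (forall i, 0 <= th i <= 1) -> `|v + \sum_(i <- r) th i *: u i| <= M.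
Proof.
move=> + + th01; elim: r v => [|a r IH] v /=.
  by move=> _ /(_ xpredT); rewrite !big_nil.
move=> /andP[ar ur] H; rewrite big_cons addrA; apply: IH => // G.
have /andP[t0 t1] := th01 a.
have H0 : `|v + \sum_(i <- r | G i) u i| <= M.
  have := H (fun i => (i != a) && G i); rewrite big_cons eqxx/=.
  rewrite big_seq_cond [in X in _ -> X]big_seq_cond; congr (`| _ + _| <= _).
  apply: eq_bigl => i; case ir: (i \in r) => //=.
  by case: eqP => // ia; rewrite -ia ir in ar.
have H1 : `|v + u a + \sum_(i <- r | G i) u i| <= M.
  have := H (fun i => (i == a) || G i); rewrite big_cons eqxx/= addrA.
  rewrite big_seq_cond [in X in _ -> X]big_seq_cond; congr (`| _ + _| <= _).
  apply: eq_bigl => i; case ir: (i \in r) => //=.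
  by case: eqP => // ia; rewrite -ia ir in ar.
set s := \sum_(i <- r | G i) u i in H0 H1 *.
have -> : v + th a *: u a + s = (1 - th a) *: (v + s) + th a *: (v + u a + s).
  rewrite (addrAC v (u a)) (scalerDr (th a) (v + s)) addrA -scalerDl subrK.
  by rewrite scale1r addrAC.
rewrite (le_trans (ler_normD _ _))// !normrZ (ger0_norm t0) ger0_norm ?subr_ge0//.
have -> : M = (1 - th a) * M + th a * M by ring.
by rewrite lerD// ler_wpM2l// subr_ge0.
Qed.

(** Writing th = 2 (1 + th)/2 - 1 reduces to coefficients in [0, 1]; the two terms contribute 2 M
    and M. *)
Lemma norm_sum_sign_cube u m n M (th : nat -> R) :
  (forall G, `|\sum_(m <= i < n | G i) u i| <= M) ->
  (forall i, `|th i| <= 1) -> `|\sum_(m <= i < n) th i *: u i| <= 3 * M.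
Proof.
move=> H th1.
have -> : \sum_(m <= i < n) th i *: u i =
   2 *: \sum_(m <= i < n) ((1 + th i) / 2) *: u i - \sum_(m <= i < n) u i.
  rewrite scaler_sumr -sumrB; apply: eq_bigr => i _.
  rewrite scalerA -[X in _ - X]scale1r -scalerBl; by congr (_ *: _); field.
apply: (@le_trans _ _ (2 * M + M)); last by lra.
rewrite (le_trans (ler_normB _ _))// lerD//.
rewrite normrZ ger0_norm// ler_wpM2l//.
rewrite -[X in `|X|]add0r; apply: norm_sum_cube; first exact: iota_uniq.
  by move=> G; rewrite add0r.
by move=> i; have := th1 i; rewrite ler_norml; lra.
Qed.

Lemma uncond_multiplier_tail u : unconditionally_cvg u -> forall e : R, 0 < e ->
  exists N, forall m n (th : nat -> R), (N <= m)%N -> (forall i, `|th i| <= 1) ->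
    `|\sum_(m <= i < n) th i *: u i| <= e.
Proof.
move=> uu e e0; have e3 : 0 < e / 3 by lra.
have [N HN] := uncond_subset_tail uu e3.
exists N => m n th Nm th1; apply: (@le_trans _ _ (3 * (e / 3))); last by lra.
by apply: norm_sum_sign_cube => // G; exact/ltW/HN.
Qed.

End Sums.

(** * Zabreiko's lemma on countably subadditive seminorms *)

Section Zabreiko.
Variables (R : realType) (U : completeNormedModType R) (p : U -> R).
Hypothesis pD : forall x y, p (x + y) <= p x + p y.
Hypothesis pZ : forall a x, p (a *: x) = `|a| * p x.

Let p0 : p 0 = 0.
Proof. by rewrite -(scale0r 0) pZ normr0 mul0r. Qed.

Let p_ge0 x : 0 <= p x.
Proof.
have := pD x (-1 *: x); rewrite pZ normrN1 mul1r scaleN1r subrr p0; lra.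
Qed.

(** By Baire's theorem some set [A n] is dense in a ball around a point [x0]. Approximating
    [x0 + t *: y] and [x0] by points of that set and subtracting removes the centre; dividing by [t]
    reaches an arbitrary [y]. *)
Lemma seminorm_approx : exists2 M : R, 0 <= M & forall (y : U) (e : R), 0 < e ->
  exists w, p w <= M * `|y| /\ `|y - w| < e.
Proof.
pose A n := [set x | p x <= n%:R].
have [n /denseNE[Q [[x0 [oQ Qx0]] QA]]] : exists n, ~ dense (~` closure (A n)).
  apply: contrapT => /forallNP H.
  have /(_ setT) : dense (\bigcap_n (~` closure (A n))).
    apply: Baire => n; split; last exact: contrapT (H n).
    by apply: closed_openC; exact: closed_closure.
  case; [by exists 0|exact: openT|move=> x [_ /(_ (Num.truncn (p x)).+1 Logic.I)]]; apply.
  by apply: subset_closure; rewrite /A /=; exact/ltW/truncnS_gt.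
have /nbhs_ballP[r /= r0 rQ] : nbhs x0 Q by apply: open_nbhs_nbhs.
have H (y : U) (e : R) : `|y| < r -> 0 < e -> exists w, p w <= n%:R /\ `|x0 + y - w| < e.
  move=> yr e0.
  have : closure (A n) (x0 + y).
    apply: contrapT => nA; have : (Q `&` ~` closure (A n)) (x0 + y).
      split => //; apply: rQ; rewrite -ball_normE /ball_/=.
      by rewrite opprD addrA subrr sub0r normrN.
    by rewrite QA.
  move=> /(_ (ball (x0 + y) e))/(_ (nbhsx_ballx _ _ e0))[w [Aw]].
  by rewrite -ball_normE => ?; exists w.
have n0 : 0 <= n%:R :> R by [].
exists (4 * n%:R / r) => [|y e e0]; first by rewrite !mulr_ge0// invr_ge0 ltW.
have [->|y0] := eqVneq y 0.
  by exists 0; rewrite p0 subrr normr0 mulr0.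
(* The factor [t] gives [t *: y] the norm [r / 2]. As [p (a - b)] is at most [2 * n%:R], dividing by
   [t] yields the constant [4 * n%:R / r]. *)
have ny : 0 < `|y| by rewrite normr_gt0.
pose t := r / (2 * `|y|); have t0 : 0 < t by rewrite divr_gt0// mulr_gt0.
have te : 0 < t * e / 2 by rewrite divr_gt0// mulr_gt0.
have ty : `|t *: y| < r.
  rewrite normrZ gtr0_norm// /t invfM mulrA mulfVK ?gt_eqF//; lra.
have [a [pa ya]] := H _ _ ty te.
have [|b [pb yb]] := H 0 _ _ te; first by rewrite normr0.
rewrite addr0 in yb.
exists (t^-1 *: (a - b)); split.
  rewrite pZ gtr0_norm ?invr_gt0//.
  have := pD a (-1 *: b); rewrite pZ normrN1 mul1r scaleN1r => pab.
  have -> : 4 * n%:R / r * `|y| = t^-1 * (2 * n%:R).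
    by rewrite /t; field; rewrite !gt_eqF.
  by apply: ler_wpM2l; [rewrite invr_ge0 ltW|lra].
have -> : y - t^-1 *: (a - b) = t^-1 *: ((x0 + t *: y - a) - (x0 - b)).
  rewrite -[X in X - _](scalerK (lt0r_neq0 t0)) -scalerBr; congr (_ *: _).
  by rewrite !opprB [RHS]addrC -(addrA x0) addrA subrK addrCA.
rewrite normrZ gtr0_norm ?invr_gt0// mulrC ltr_pdivrMr//.
by rewrite (le_lt_trans (ler_normB _ _))//; lra.
Qed.

Lemma zabreiko :
  (forall (u : nat -> U) x C, series u @ \oo --> x ->
    (forall K, series (p \o u) K <= C) -> p x <= C) ->
  exists2 M, 0 <= M & forall x, p x <= M * `|x|.
Proof.
move=> pS; have [M M0 HM] := seminorm_approx.
have exW (t : U * R) : exists w, 0 < t.2 ->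
    p w <= M * `|t.1| /\ `|t.1 - w| < t.2.
  by case: t => y e /=; case: (ltP 0 e) => [/(HM y)[w]|_]; [exists w|exists 0].
have [W HW] := choice exW.
exists (2 * M) => [|x]; first by rewrite mulr_ge0.
have [->|x0] := eqVneq x 0; first by rewrite p0 normr0 mulr0.
have nx : 0 < `|x| by rewrite normr_gt0.
(* [ys k] is the remainder after [k] approximations. The tolerances halve, so the pieces [w k] sum
   to [x] and their [p]-values are dominated by a geometric series of sum 2 M |x|. *)
pose ys := fix ys k := if k is k'.+1 then ys k' - W (ys k', `|x| / 2 ^+ k) else x.
pose w k := W (ys k, `|x| / 2 ^+ k.+1).
have e0 k : 0 < `|x| / 2 ^+ k by rewrite divr_gt0// exprn_gt0.
have ysS k : ys k.+1 = ys k - w k by [].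
have ys_le k : `|ys k| <= `|x| / 2 ^+ k.
  case: k => [|k]; first by rewrite expr0 divr1.
  by rewrite ysS; have [_ /ltW] := HW (ys k, _) (e0 k.+1).
have wx K : series w K = x - ys K.
  elim: K => [|K IH]; first by rewrite /series/= big_geq// subrr.
  by rewrite seriesSr IH ysS opprB -addrA [- _ + _]addrC.
apply: (pS w).
  have -> : series w = (fun K => x - ys K) by apply/funext => K; rewrite wx.
  rewrite -[X in _ --> X]subr0; apply: cvgB; first exact: cvg_cst.
  apply: norm_cvg0; apply: (@squeeze_cvgr _ _ _ _ (cst 0) (geometric `|x| 2^-1)).
  - by apply: nearW => k; rewrite normr_ge0 /= exprVn ys_le.
  - exact: cvg_cst.
  - by apply: cvg_geometric; rewrite ger0_norm; lra.
have pw k : p (w k) <= M * (`|x| / 2 ^+ k).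
  have [+ _] := HW (ys k, _) (e0 k.+1); move/le_trans; apply.
  by apply: ler_wpM2l => //; exact: ys_le.
(* Subtracting the remaining geometric tail makes the bound provable by induction on [K]. *)
move=> K; apply: (@le_trans _ _ (2 * M * `|x| - 2 * (M * (`|x| / 2 ^+ K)))); last first.
  by rewrite gerBl mulr_ge0// mulr_ge0// ltW.
elim: K => [|K IH]; first by rewrite /series/= big_geq// expr0 divr1 mulrA subrr.
rewrite seriesSr /=; have := pw K.
have -> : `|x| / 2 ^+ K.+1 = (`|x| / 2 ^+ K) / 2 by rewrite exprSr invfM mulrA.
move: IH; lra.
Qed.

End Zabreiko.

(** * Coordinates with respect to the basis *)

Section UnconditionalBasis.
Variables (R : realType) (Z : completeNormedModType R) (z : nat -> Z).
Hypothesis hz : unconditional_basis z.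

Definition coef n (x : Z) : R := sval (cid (hz.1 x)) n.

Lemma coef_cvg x : series (fun n => coef n x *: z n) @ \oo --> x.
Proof. by have [] := svalP (cid (hz.1 x)). Qed.

Lemma coef_unique x a : series (fun n => a n *: z n) @ \oo --> x ->
  coef ^~ x = a.
Proof. by move=> ax; have [_] := svalP (cid (hz.1 x)); exact. Qed.

Lemma coef_linear n : scalar (coef n).
Proof.
move=> a x y.
have /(congr1 (fun f => f n)) //: coef ^~ (a *: x + y) =
  (fun k => a * coef k x + coef k y).
apply: coef_unique.
have -> : series (fun n => (a * coef n x + coef n y) *: z n) =
    (fun N => a *: series (fun n => coef n x *: z n) N +
              series (fun n => coef n y *: z n) N).
  apply/funext => N; rewrite /series/= scaler_sumr -big_split/=.
  by apply: eq_bigr => i _; rewrite scalerDl scalerA.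
by apply: cvgD; [apply: cvgZr|]; exact: coef_cvg.
Qed.

HB.instance Definition _ n :=
  GRing.isLinear.Build R Z R *%R (coef n) (coef_linear n).

Lemma coef_basis n k : coef k (z n) = (k == n)%:R.
Proof.
have /(congr1 (fun f => f k)) //: coef ^~ (z n) = (fun k => (k == n)%:R).
apply: coef_unique; apply: (@cvg_near_cst _ _ _ _ \oo); near=> N.
have nN : (n < N)%N by near: N; exists n.+1.
rewrite /series/= big_mkord (bigD1 (Ordinal nN))//= eqxx scale1r big1 ?addr0//.
by move=> i; rewrite -val_eqE/= => /negbTE ->; rewrite scale0r.
Unshelve. all: by end_near. Qed.

Lemma basis_neq0 n : z n != 0.
Proof.
apply/eqP => zn; have := coef_basis n n; rewrite zn eqxx.
by rewrite linear0 => /esym/eqP; rewrite oner_eq0.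
Qed.

End UnconditionalBasis.

Lemma norm_cvg_le (R : realType) (V : normedModType R) (f : nat -> V) (l c : V)
    (M : R) (K : nat) : f @ \oo --> l ->
  (forall n, (K <= n)%N -> `|f n - c| <= M) -> `|l - c| <= M.
Proof.
move=> fl fM; have : `|f n - c| @[n --> \oo] --> `|l - c|.
  by apply: cvg_norm; apply: cvgB => //; exact: cvg_cst.
by move/cvgr_to_le; apply; exists K.
Qed.

(** * The unconditional seminorm and its boundedness *)

Section UnconditionalConstant.
Variables (R : realType) (Z : completeNormedModType R) (z : nat -> Z).
Hypothesis hz : unconditional_basis z.
Local Notation coef := (coef hz).

Definition mult (th : nat -> R) N (x : Z) : Z :=
  \sum_(0 <= i < N) th i *: (coef i x *: z i).

Lemma mult_linear th N : linear (mult th N).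
Proof.
move=> a x y; rewrite /mult scaler_sumr -big_split/=; apply: eq_bigr => i _.
rewrite linearP scalerDl scalerDr; congr (_ + _).
by rewrite !scalerA; congr (_ *: _); rewrite mulrCA mulrA.
Qed.

HB.instance Definition _ th N :=
  GRing.isLinear.Build R Z Z *:%R (mult th N) (mult_linear th N).

Lemma coef_uncond x : unconditionally_cvg (fun n => coef n x *: z n).
Proof. by apply: hz.2; apply/cvg_ex; exists x; exact: coef_cvg. Qed.

Let mult_norms x :=
  [set `|mult t.1 t.2 x| | t in [set t : (nat -> R) * nat | forall i, `|t.1 i| <= 1]].

(** This is the seminorm p of the opening comment. *)
Definition uncond_norm x : R := sup (mult_norms x).

(** Beyond some [N0] all multiplier sums have norm at most 1, uniformly in [th]; below it the
    triangle inequality suffices. *)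
Lemma uncond_norm_has_sup x : has_sup (mult_norms x).
Proof.
split; first by exists `|mult (fun=> 0) 0 x|, (fun=> 0, 0%N) => //= i; rewrite normr0.
have [N0 HN0] := uncond_multiplier_tail (@coef_uncond x) ltr01.
exists (\sum_(0 <= i < N0) `|coef i x *: z i| + 1) => _ [[th N] /= th1 <-].
have H m n : `|\sum_(m <= i < n) th i *: (coef i x *: z i)| <=
    \sum_(m <= i < n) `|coef i x *: z i|.
  apply: (le_trans (ler_norm_sum _ _ _)); apply: ler_sum => i _.
  by rewrite normrZ ler_piMl.
have [NN0|/ltnW NN0] := leqP N N0.
  apply: (le_trans (H _ _)); rewrite (big_cat_nat (n := N) (p := N0))//= -addrA.
  by rewrite lerDl addr_ge0// sumr_ge0.
rewrite /mult (big_cat_nat (n := N0))//= (le_trans (ler_normD _ _))// lerD//.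
exact: HN0.
Qed.

Lemma mult_le_uncond_norm th N x : (forall i, `|th i| <= 1) -> `|mult th N x| <= uncond_norm x.
Proof.
by move=> th1; apply: sup_upper_bound; [exact: uncond_norm_has_sup|exists (th, N)].
Qed.

Lemma uncond_norm_le x C :
  (forall th N, (forall i, `|th i| <= 1) -> `|mult th N x| <= C) -> uncond_norm x <= C.
Proof.
move=> H; apply: ge_sup; first exact: (uncond_norm_has_sup x).1.
by move=> _ [[th N] /= th1 <-]; exact: H.
Qed.

Lemma uncond_norm_ge0 x : 0 <= uncond_norm x.
Proof.
apply: le_trans (@mult_le_uncond_norm (fun=> 0) 0%N x _); first exact: normr_ge0.
by move=> i; rewrite normr0.
Qed.

Lemma uncond_normD x y : uncond_norm (x + y) <= uncond_norm x + uncond_norm y.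
Proof.
apply: uncond_norm_le => th N th1; rewrite linearD (le_trans (ler_normD _ _))// lerD//;
  exact: mult_le_uncond_norm.
Qed.

Lemma uncond_normZ_le a x : uncond_norm (a *: x) <= `|a| * uncond_norm x.
Proof.
apply: uncond_norm_le => th N th1; rewrite linearZ normrZ ler_wpM2l//.
exact: mult_le_uncond_norm.
Qed.

Lemma uncond_normZ a x : uncond_norm (a *: x) = `|a| * uncond_norm x.
Proof.
apply/eqP; rewrite eq_le uncond_normZ_le /=.
have [->|a0] := eqVneq a 0; first by rewrite normr0 mul0r uncond_norm_ge0.
rewrite mulrC -ler_pdivlMr ?normr_gt0// mulrC -normfV.
by apply: le_trans (uncond_normZ_le _ _); rewrite scalerA mulVf// scale1r.
Qed.

(** The indicator of [n] as multiplier isolates one term. Norm continuity of the coordinates is not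
    established at this stage, and this domination takes its place. *)
Lemma coef_le_uncond_norm n x : `|coef n x| <= uncond_norm x / `|z n|.
Proof.
rewrite ler_pdivlMr ?normr_gt0 ?basis_neq0// -normrZ.
have H i : `|(i == n)%:R| <= 1 :> R by case: (i == n); rewrite ?normr1 ?normr0.
apply: le_trans (mult_le_uncond_norm n.+1 x H); rewrite /mult big_nat_recr//= eqxx scale1r.
rewrite big_nat big1 ?add0r// => i /= iltn.
by rewrite ltn_eqF// scale0r.
Qed.

Lemma mult1 N x : mult (fun=> 1) N x = series (fun n => coef n x *: z n) N.
Proof. by apply: eq_bigr => i _; rewrite scale1r. Qed.

(** Summability of the seminorms makes the coordinates of the partial sums converge, and the limits
    turn out to be the coordinates of [x]. Each truncated multiplier of [x] is then a limit of those
    of the partial sums, all bounded by [C]. *)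
Lemma uncond_norm_countably_subadditive (u : nat -> Z) x C : series u @ \oo --> x ->
  (forall K, series (uncond_norm \o u) K <= C) -> uncond_norm x <= C.
Proof.
move=> ux uC; pose q := series (uncond_norm \o u).
have q_cvg : cvgn q.
  apply: nondecreasing_is_cvgn; last by exists C => _ [K _ <-].
  apply/nondecreasing_seqP => K; rewrite /q seriesSr lerDl; exact: uncond_norm_ge0.
have uncond_norm_tail K K' : (K <= K')%N ->
    uncond_norm (series u K' - series u K) <= q K' - q K.
  move=> /subnK <-; elim: (K' - K)%N => [|d IH].
    by rewrite !subrr -(scale0r 0) uncond_normZ normr0 mul0r.
  rewrite addSn /q !seriesSr -/q addrAC [leRHS]addrAC.
  by apply: (le_trans (uncond_normD _ _)); rewrite lerD2r.
have uncond_norm_series K : uncond_norm (series u K) <= q K.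
  have := uncond_norm_tail 0%N K (leq0n K).
  have -> : series u 0 = 0 by rewrite /series/= big_geq.
  by have -> : q 0%N = 0; [rewrite /q /series/= big_geq|rewrite !subr0].
pose y i := limn (series (coef i \o u)).
have coef_series i K : series (coef i \o u) K = coef i (series u K).
  by rewrite /series/= linear_sum.
have y_cvg i : coef i (series u K) @[K --> \oo] --> y i.
  under eq_cvg do rewrite -coef_series.
  apply: normed_cvg; apply: (@series_le_cvg _ _ (fun k => uncond_norm (u k) / `|z i|)).
  - by move=> k; exact: normr_ge0.
  - by move=> k; rewrite mulr_ge0 ?uncond_norm_ge0// invr_ge0.
  - by move=> k; exact: coef_le_uncond_norm.
  have -> : (fun k => uncond_norm (u k) / `|z i|) = `|z i|^-1 *: (uncond_norm \o u).
    by apply/funext => k; rewrite mulrC.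
  exact: is_cvg_seriesZ.
have mult_cvg th N : mult th N (series u K) @[K --> \oo] -->
    \sum_(0 <= i < N) th i *: (y i *: z i).
  elim: N => [|N IH]; first by rewrite /mult; under eq_cvg do rewrite big_geq//;
    rewrite big_geq//; exact: cvg_cst.
  under eq_cvg do rewrite /mult big_nat_recr//.
  rewrite big_nat_recr//; apply: cvgD IH _.
  by apply: cvgZr; apply: cvgZl; exact: y_cvg.
(* The error splits into three parts, each at most [e / 3]: [x] minus a partial sum of [u], the
   expansion error of that partial sum, and a difference of truncations bounded by a tail of [q]
   whatever the length [N]. *)
have y_coef : coef ^~ x = y.
  apply: coef_unique; apply/cvgrPdist_le => e e0.
  have e3 : 0 < e / 3 by lra.
  have q_le K : q K <= limn q.
    apply: nondecreasing_cvgn_le => //; apply/nondecreasing_seqP => k.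
    by rewrite /q seriesSr lerDl; exact: uncond_norm_ge0.
  have [K [xK qK]] : exists K, `|x - series u K| <= e / 3 /\ `|limn q - q K| <= e / 3.
    near \oo => K; exists K; split; near: K.
      by move/cvgrPdist_le: ux; exact.
    by move/cvgrPdist_le: q_cvg; exact.
  have /cvgrPdist_le/(_ _ e3) := @coef_cvg _ _ _ hz (series u K).
  apply: filterS => N; rewrite -mult1 => KN.
  have yN : `|series (fun n => y n *: z n) N - mult (fun=> 1) N (series u K)| <= e / 3.
    have := mult_cvg (fun=> 1) N; under eq_bigr do rewrite scale1r.
    move/(@norm_cvg_le _ _ _ _ (mult (fun=> 1) N (series u K)) (e / 3) K); apply.
    move=> K' KK'; rewrite -linearB; apply: le_trans (mult_le_uncond_norm _ _ _) _.
      by move=> i; rewrite normr1.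
    apply: le_trans (uncond_norm_tail _ _ KK') _; apply: le_trans _ qK.
    by apply: le_trans (ler_norm _); rewrite lerD2r.
  have -> : x - series (fun n => y n *: z n) N = (x - series u K) +
      (series u K - mult (fun=> 1) N (series u K)) -
      (series (fun n => y n *: z n) N - mult (fun=> 1) N (series u K)).
    by rewrite opprB !addrA !subrK.
  have := ler_normB ((x - series u K) +
      (series u K - mult (fun=> 1) N (series u K)))
      (series (fun n => y n *: z n) N - mult (fun=> 1) N (series u K)).
  have := ler_normD (x - series u K) (series u K - mult (fun=> 1) N (series u K)).
  move: xK KN yN; lra.
apply: uncond_norm_le => th N th1; rewrite -[X in `|X|]subr0.
have := mult_cvg th N; rewrite -y_coef => /(@norm_cvg_le _ _ _ _ 0 C 0%N); apply.
move=> K _; rewrite subr0 (le_trans (mult_le_uncond_norm _ _ th1))//.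
exact: le_trans (uncond_norm_series K) (uC K).
Unshelve. all: by end_near. Qed.

Lemma uncond_norm_bounded : exists2 M, 0 <= M & forall x, uncond_norm x <= M * `|x|.
Proof. exact: zabreiko uncond_normD uncond_normZ uncond_norm_countably_subadditive. Qed.

End UnconditionalConstant.

Lemma bop_continuous (R : realType) (U V : normedModType R) (f : bop U V) :
  continuous f.
Proof.
have [_ [M fM]] := bopP f; apply/linear_bounded_continuous/bounded_funP => r.
exists (`|M| * r) => x xr; apply: (le_trans (fM x)).
by apply: (le_trans (ler_norm _)); rewrite normrM normr_id ler_wpM2l.
Qed.

(** * Diagonal multipliers on Z and expansions of functionals *)

Section Multipliers.
Variables (R : realType) (Z : completeNormedModType R) (z : nat -> Z).
Hypothesis hz : unconditional_basis z.
Local Notation coef := (coef hz).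

(** The limit is meaningful for bounded [mu], where [dmul_cvg] provides convergence. *)
Definition dmul (mu : nat -> R) x : Z := limn (fun N => mult hz mu N x).

Section Bounded.
Variables (mu : nat -> R) (B : R).
Hypothesis muB : forall i, `|mu i| <= B.

Let B_ge0 : 0 <= B. Proof. exact: le_trans (muB 0%N). Qed.

Let mu_div i : `|mu i / B| <= 1 /\ mu i = B * (mu i / B).
Proof.
(* When [B] is 0 all [mu i] vanish, and the convention 0 / 0 = 0 keeps both claims true. *)
have [B0|B0] := eqVneq B 0; last first.
  split; last by rewrite mulrC divfK.
  by rewrite normrM normfV (ger0_norm B_ge0) ler_pdivrMr ?mul1r// lt0r B0.
have := muB i; rewrite B0 normr_le0 => /eqP ->.
by rewrite mul0r normr0 mul0r ler01.
Qed.

Let sum_mu (u : nat -> Z) m n :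
  \sum_(m <= i < n) mu i *: u i = B *: \sum_(m <= i < n) (mu i / B) *: u i.
Proof.
by rewrite scaler_sumr; apply: eq_bigr => i _; rewrite scalerA -(mu_div i).2.
Qed.

Lemma dmul_cvg x : mult hz mu N x @[N --> \oo] --> dmul mu x.
Proof.
rewrite -/(cvgn _).
rewrite -[X in cvgn X]/(series (fun i => mu i *: (coef i x *: z i))).
apply/cauchy_cvgP/cauchy_seriesP => e e0.
(* [B + 1] is a nonzero divisor even for [B] equal to 0, and B e / (B + 1) stays strictly below
   [e]. *)
have B1 : 0 < B + 1 by have := B_ge0; lra.
have [N HN] := uncond_multiplier_tail (@coef_uncond _ _ _ hz x) (divr_gt0 e0 B1).
exists ([set n | (N <= n)%N], [set n | (N <= n)%N]) => /=.
  by split; exists N.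
move=> [m n] [/= Nm _]; rewrite sum_mu normrZ (ger0_norm B_ge0).
have := HN m n _ Nm (fun i => (mu_div i).1) => /(ler_wpM2l B_ge0)/le_lt_trans; apply.
by rewrite mulrCA gtr_pMr// ltr_pdivrMr// mul1r; lra.
Qed.

Lemma dmul_norm x : `|dmul mu x| <= B * uncond_norm hz x.
Proof.
rewrite -[X in `|X|]subr0; have := @dmul_cvg x.
move=> /(@norm_cvg_le _ _ _ _ 0 (B * uncond_norm hz x) 0%N); apply=> N _.
rewrite subr0 [mult hz mu N x]sum_mu normrZ (ger0_norm B_ge0).
by apply: ler_wpM2l => //; apply: mult_le_uncond_norm => i; exact: (mu_div i).1.
Qed.

Lemma dmul_linear : linear (dmul mu).
Proof.
move=> a x y; apply: cvg_lim => //.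
under eq_cvg do rewrite linearP.
by apply: cvgD; [apply: cvgZr|]; exact: dmul_cvg.
Qed.

Lemma dmul_basis n : dmul mu (z n) = mu n *: z n.
Proof.
apply: cvg_lim => //; apply: (@cvg_near_cst _ _ _ _ \oo); near=> N.
have nN : (n < N)%N by near: N; exists n.+1.
rewrite /mult big_mkord (bigD1 (Ordinal nN))//= coef_basis eqxx scale1r.
rewrite big1 ?addr0// => i; rewrite -val_eqE/= coef_basis => /negbTE ->.
by rewrite scale0r scaler0.
Unshelve. all: by end_near. Qed.

End Bounded.

Section Functional.
Variable f : bop Z R.

Lemma series_functional x N :
  series (fun n => f (z n) * coef n x) N = f (mult hz (fun=> 1) N x).
Proof.
rewrite /mult linear_sum; apply: eq_bigr => i _.
by rewrite scale1r linearZ/= mulrC.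
Qed.

Lemma functional_cvg x : series (fun n => f (z n) * coef n x) @ \oo --> f x.
Proof.
under eq_cvg do rewrite series_functional mult1.
apply: continuous_cvg; first exact: bop_continuous.
exact: coef_cvg.
Qed.

Lemma series_functional_le x N :
  `|series (fun n => f (z n) * coef n x) N| <= `|f| * uncond_norm hz x.
Proof.
rewrite series_functional; apply: le_trans (opnorm_bound _ _) _.
rewrite -bop_normE; apply: ler_wpM2l => //.
by apply: mult_le_uncond_norm => i; rewrite normr1.
Qed.

End Functional.

End Multipliers.

(** * The Banach space of convergent scalar series *)

Section ConvergentSeries.
Variable R : realType.

Definition cs_pred : {pred nat -> R} := mem [set c : nat -> R | cvgn (series c)].

Lemma series_linear (V : lmodType R) (a : R) (c d : nat -> V) n :
  series (a *: c + d) n = a *: series c n + series d n.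
Proof. by rewrite /series/= scaler_sumr -big_split. Qed.

Lemma cs_submod_closed : submod_closed cs_pred.
Proof.
split=> [|a c d].
  rewrite inE; apply/cvg_ex; exists 0; apply: cvg_near_cst; apply: nearW => n.
  by rewrite /series/= big1.
rewrite !inE => /= cc cd; suff -> : series (a *: c + d) = a *: series c + series d.
  by apply: is_cvgD => //; exact: is_cvgZr.
by apply/funext => n; exact: series_linear.
Qed.

HB.instance Definition _ :=
  GRing.isSubmodClosed.Build R (nat -> R) cs_pred cs_submod_closed.

Record cs := Cs { cs_seq :> nat -> R; cs_in : cs_seq \in cs_pred }.

HB.instance Definition _ := [isSub for cs_seq].
HB.instance Definition _ := [Choice of cs by <:].
HB.instance Definition _ := [SubChoice_isSubLmodule of cs by <:].

Implicit Types c d : cs.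

Lemma cs_cvg c : cvgn (series c).
Proof. by have := cs_in c; rewrite inE. Qed.

Definition psum n c : R := series c n.

Lemma psum_linear n : scalar (psum n).
Proof. by move=> a c d; exact: series_linear. Qed.

HB.instance Definition _ n :=
  GRing.isLinear.Build R cs R *%R (psum n) (psum_linear n).

Lemma psum0 c : psum 0 c = 0.
Proof. by rewrite /psum /series/= big_geq. Qed.

Lemma cs_seqE c n : c n = psum n.+1 c - psum n c.
Proof. by rewrite /psum seriesSr addrC addKr. Qed.

Lemma psum_inj c d : psum ^~ c =1 psum ^~ d -> c = d.
Proof. by move=> cd; apply: val_inj; apply/funext => n; rewrite /= !cs_seqE !cd. Qed.

Definition cs_norm c : R := sup (range (fun n => `|psum n c|)).

Lemma cs_norm_has_sup c : has_sup (range (fun n => `|psum n c|)).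
Proof.
split; first by exists `|psum 0 c|, 0%N.
have /cvg_seq_bounded/pinfty_ex_gt0[M _ HM] := @cs_cvg c.
by exists M => _ [n _ <-]; exact: HM.
Qed.

Lemma psum_le n c : `|psum n c| <= cs_norm c.
Proof. by apply: sup_upper_bound; [exact: cs_norm_has_sup|exists n]. Qed.

Lemma cs_norm_le c (M : R) : (forall n, `|psum n c| <= M) -> cs_norm c <= M.
Proof.
move=> cM; apply: ge_sup; first exact: (cs_norm_has_sup c).1.
by move=> _ [n _ <-].
Qed.

Lemma cs_normD c d : cs_norm (c + d) <= cs_norm c + cs_norm d.
Proof.
apply: cs_norm_le => n; rewrite linearD (le_trans (ler_normD _ _))// lerD//;
  exact: psum_le.
Qed.

Lemma cs_normZ_le (a : R) c : cs_norm (a *: c) <= `|a| * cs_norm c.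
Proof.
by apply: cs_norm_le => n; rewrite linearZ normrM ler_wpM2l// psum_le.
Qed.

Lemma cs_norm_ge0 c : 0 <= cs_norm c.
Proof. exact: le_trans (psum_le 0 c). Qed.

Lemma cs_normZ (a : R) c : cs_norm (a *: c) = `|a| * cs_norm c.
Proof.
apply/eqP; rewrite eq_le cs_normZ_le /=.
have [->|a0] := eqVneq a 0; first by rewrite normr0 mul0r cs_norm_ge0.
rewrite mulrC -ler_pdivlMr ?normr_gt0// mulrC -normfV.
by apply: le_trans (cs_normZ_le _ _); rewrite scalerA mulVf// scale1r.
Qed.

Lemma cs_norm0_eq0 c : cs_norm c = 0 -> c = 0.
Proof.
move=> c0; apply: psum_inj => n; rewrite linear0; apply/eqP.
by rewrite -normr_le0 -c0 psum_le.
Qed.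

HB.instance Definition _ :=
  @Lmodule_isNormed.Build R cs cs_norm cs_normD cs_normZ cs_norm0_eq0.

(** Each [psum n] is a contraction, so the partial sums converge along [F], uniformly in [n]. Their
    limits [L] form a convergent sequence, and its successive differences are the terms of the limit
    series. *)
Lemma cs_complete (F : set_system cs) : ProperFilter F -> cauchy F -> cvg F.
Proof.
move=> FF /cauchyP F_cauchy.
have psumF n : cvg (psum n @ F).
  apply/cauchy_cvgP/cauchyP => e e0; have [c Fc] := F_cauchy e e0.
  exists (psum n c); suff : F (psum n @^-1` ball (psum n c) e) by [].
  apply: filterS Fc => d; rewrite -!ball_normE /ball_/=.
  by rewrite -(linearB (psum n)) => /(le_lt_trans (psum_le n _)).
pose L n := lim (psum n @ F).
have L_close (c : cs) (e : R) : F (ball c e) -> forall n, `|psum n c - L n| <= e.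
  move=> Fc n; have : `|psum n c - psum n d| @[d --> F] --> `|psum n c - L n|.
    by apply: cvg_norm; apply: cvgB; [exact: cvg_cst|exact: psumF].
  move/cvgr_to_le; apply; apply: filterS Fc => d; rewrite -ball_normE /ball_/=.
  by rewrite -(linearB (psum n)) => /ltW/(le_trans (psum_le n _)).
have L0 : L 0%N = 0.
  apply: cvg_lim => //; apply: cvg_near_cst; apply: nearW => c; exact: psum0.
have LE : series (fun n => L n.+1 - L n) = L.
  by apply/funext => n; rewrite /series/= telescope_sumr// L0 subr0.
(* A uniform limit of convergent sequences is Cauchy: [L n] is compared with the sum of one nearby
   series [c]. *)
have L_cvg : cvgn L.
  apply/cauchy_cvgP/cauchy_exP => e e0; have e3 : 0 < e / 3 by lra.
  have [c /L_close Lc] := F_cauchy _ e3.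
  have /cvgrPdist_lt/(_ _ e3) := @cs_cvg c => lc0.
  exists (limn (series c)); apply: filterS lc0 => n lc.
  rewrite -ball_normE /ball_/= -(subrK (psum n c) (limn _)) -addrA.
  by rewrite (le_lt_trans (ler_normD _ _))//; have := Lc n; move: lc; rewrite /psum; lra.
have Lcs : (fun n => L n.+1 - L n) \in cs_pred by rewrite inE /= LE.
apply/cvg_ex; exists (Cs Lcs); apply/cvgrPdist_le => e e0.
have e2 : 0 < e / 2 by lra.
have [c Fc] := F_cauchy _ e2; apply: filterS (Fc) => d.
rewrite -ball_normE /ball_/= => cd.
rewrite -(subrK c (Cs Lcs)) -addrA (le_trans (ler_normD _ _))//.
have -> : e = e / 2 + e / 2 by lra.
apply: lerD; last exact: ltW.
apply: cs_norm_le => n; rewrite linearB/= distrC.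
by rewrite /psum/= LE; exact: L_close.
Qed.

HB.instance Definition _ := Uniform_isComplete.Build cs cs_complete.

End ConvergentSeries.

(** * Completeness and convergence in products *)

Lemma prod_complete (R : realType) (U V : completeNormedModType R)
    (F : set_system ((U * V)%type : normedModType R)) :
  ProperFilter F -> cauchy F -> cvg F.
Proof.
move=> FF /cauchyP F_cauchy.
have F1 : cvg (fst @ F).
  apply/cauchy_cvgP/cauchyP => e e0; have [[x y] Fxy] := F_cauchy e e0.
  exists x; suff : F (fst @^-1` ball x e) by [].
  by apply: filterS Fxy => -[x' y'] [].
have F2 : cvg (snd @ F).
  apply/cauchy_cvgP/cauchyP => e e0; have [[x y] Fxy] := F_cauchy e e0.
  exists y; suff : F (snd @^-1` ball y e) by [].
  by apply: filterS Fxy => -[x' y'] [].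
apply/cvg_ex; exists (lim (fst @ F), lim (snd @ F)).
move=> A hA; have := cvg_pair F1 F2 hA => FA.
suff : F ((fun x => (x.1, x.2)) @^-1` A) by apply: filterS => -[x y].
exact: FA.
Qed.

HB.instance Definition _ (R : realType) (U V : completeNormedModType R) :=
  Uniform_isComplete.Build (U * V)%type (@prod_complete R U V).

Lemma cvg_prod (R : realType) (U V : normedModType R) (u : nat -> U * V)
    (x : U * V) :
  (u n).1 @[n --> \oo] --> x.1 -> (u n).2 @[n --> \oo] --> x.2 -> u @ \oo --> x.
Proof.
move=> /cvgrPdist_le u1 /cvgrPdist_le u2; apply/cvgrPdist_le => e e0.
near=> n; rewrite prod_normE ge_max; apply/andP; split; near: n.
  exact: u1.
exact: u2.
Unshelve. all: by end_near. Qed.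

(** * The unit vector basis and the sum functional on convergent series *)

Section DeltaBasis.
Variable R : realType.

Lemma delta_in n : (fun k => (k == n)%:R) \in @cs_pred R.
Proof.
rewrite inE /=; apply/cvg_ex; exists 1; apply: cvg_near_cst; near=> N.
have nN : (n < N)%N by near: N; exists n.+1.
rewrite /series/= big_mkord (bigD1 (Ordinal nN))//= eqxx big1 ?addr0//.
by move=> i; rewrite -val_eqE/= => /negbTE ->.
Unshelve. all: by end_near. Qed.

Definition delta n : cs R := Cs (delta_in n).

Lemma psum_delta m n : psum m (delta n) = (n < m)%:R.
Proof.
elim: m => [|m IH]; first by rewrite psum0.
rewrite /psum seriesSr [series _ m]IH /= ltnS [(n <= m)%N]leq_eqVlt [n == m]eq_sym.
by case: (eqVneq m n) => [->|_] /=; rewrite ?ltnn ?add0r ?addr0.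
Qed.

Lemma psum_series_delta (b : nat -> R) m N :
  psum m (series (fun n => b n *: delta n) N) = series b (minn m N).
Proof.
elim: N => [|N IH]; first by rewrite /series/= minn0 !big_geq// linear0.
rewrite seriesSr linearD/= IH linearZ/= psum_delta.
have [Nm|mN] := ltnP N m.
  by rewrite mulr1 (minn_idPr Nm) seriesSr.
by rewrite mulr0 addr0 (minn_idPl (leqW mN)).
Qed.

(** The [m]-th partial sum of the error vanishes for [m <= N] and otherwise is a difference of two
    late partial sums of [c], each within [e / 2] of the limit. *)
Lemma series_delta_cvg (c : cs R) : series (fun n => c n *: delta n) @ \oo --> c.
Proof.
apply/cvgrPdist_le => e e0; have e2 : 0 < e / 2 by lra.
have /cvgrPdist_le/(_ _ e2)[N0 _ HN0] := @cs_cvg _ c.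
exists N0 => // N /= N0N; apply: cs_norm_le => m; rewrite linearB/= psum_series_delta.
have [mN|Nm] := leqP m N; first by rewrite subrr normr0 ltW.
have := HN0 m (leq_trans N0N (ltnW Nm)); have := HN0 N N0N.
by rewrite /psum !ler_norml; lra.
Qed.

Lemma psum_cvg m (u : nat -> cs R) c : u @ \oo --> c ->
  psum m (u n) @[n --> \oo] --> psum m c.
Proof.
move=> /cvgrPdist_le uc; apply/cvgrPdist_le => e /uc; apply: filterS => n.
by rewrite -(linearB (psum m)); exact: le_trans (psum_le _ _).
Qed.

(** The functional [psum m] is continuous, and on the expansion it is constant as soon as [N]
    reaches [m]. *)
Lemma delta_coef (b : nat -> R) (c : cs R) :
  series (fun n => b n *: delta n) @ \oo --> c -> b = c.
Proof.
move=> bc; suff H m : psum m c = series b m.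
  by apply/funext => n; rewrite cs_seqE !H seriesSr addrC addKr.
rewrite -(cvg_lim (@Rhausdorff R) (psum_cvg (m := m) bc)).
apply: cvg_lim => //; apply: cvg_near_cst; near=> N.
rewrite psum_series_delta (minn_idPl _)//; near: N; exact: nbhs_infty_ge.
Unshelve. all: by end_near. Qed.

Definition cs_sum (c : cs R) : R := limn (series c).

Lemma cs_sum_linear : scalar cs_sum.
Proof.
move=> a c d; apply: cvg_lim => //.
rewrite (_ : series _ = a *: series c + series d); last first.
  by apply/funext => n; exact: series_linear.
by apply: cvgD; [apply: cvgZr|]; exact: cs_cvg.
Qed.

Lemma cs_sum_le c : `|cs_sum c| <= `|c|.
Proof.
have := @cs_cvg _ c => /(@norm_cvg_le _ _ _ _ 0 `|c| 0%N); rewrite subr0; apply=> n _.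
by rewrite subr0; exact: psum_le.
Qed.

End DeltaBasis.

(** * The space X and its Schauder basis *)

Section Construction.
Variables (R : realType) (Z : completeNormedModType R) (z : nat -> Z).
Hypothesis hz : unconditional_basis z.

Definition host : completeNormedModType R := (cs R * Z)%type.

Local Notation X := host.

Definition xbasis k : X :=
  if odd k then (delta R k./2, `|z k./2|^-1 *: z k./2) else (delta R k./2, 0).

Lemma xbasis_double n : xbasis n.*2 = (delta R n, 0).
Proof. by rewrite /xbasis odd_double doubleK. Qed.

Lemma xbasis_doubleS n : xbasis n.*2.+1 = (delta R n, `|z n|^-1 *: z n).
Proof. by rewrite /xbasis /= odd_double uphalf_double. Qed.

Lemma series_xbasis_double (a : nat -> R) N :
  series (fun k => a k *: xbasis k) N.*2 =
  (series (fun n => (a n.*2 + a n.*2.+1) *: delta R n) N,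
   series (fun n => (a n.*2.+1 / `|z n|) *: z n) N) :> X.
Proof.
elim: N => [|N IH]; first by rewrite /series/= !big_geq.
rewrite doubleS !seriesSr IH xbasis_double xbasis_doubleS.
by congr (_, _); rewrite /= ?scaler0 ?addr0 ?scalerDl ?addrA ?scalerA.
Qed.

Lemma double_cvg : n.*2 @[n --> \oo] --> \oo.
Proof.
by move=> A [N _ NA]; exists N => // n /= Nn; apply: NA => /=; lia.
Qed.

Lemma half_cvg : n./2 @[n --> \oo] --> \oo.
Proof.
by move=> A [N _ NA]; exists N.*2 => // n /= Nn; apply: NA => /=; lia.
Qed.

(** The second component forces the coefficients at odd indices; those at even indices then correct
    the first component. *)
Definition xcoef (x : X) k : R :=
  if odd k then `|z k./2| * coef hz k./2 x.2
  else x.1 k./2 - `|z k./2| * coef hz k./2 x.2.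

Lemma xcoef_double x n : xcoef x n.*2 = x.1 n - `|z n| * coef hz n x.2.
Proof. by rewrite /xcoef odd_double doubleK. Qed.

Lemma xcoef_doubleS x n : xcoef x n.*2.+1 = `|z n| * coef hz n x.2.
Proof. by rewrite /xcoef /= odd_double uphalf_double. Qed.

Lemma xcoef_double_cvg x : xcoef x n.*2 @[n --> \oo] --> (0 : R).
Proof.
have c1 : x.1 n @[n --> \oo] --> (0 : R).
  by apply: cvg_series_cvg_0; exact: cs_cvg.
have c2 : `|z n| * coef hz n x.2 @[n --> \oo] --> (0 : R).
  have : (coef hz n x.2 *: z n) @[n --> \oo] --> 0.
    by apply: cvg_series_cvg_0; exact: cvgP (@coef_cvg _ _ _ hz x.2).
  move/norm_cvg0P => h; apply/norm_cvg0P; move: h; apply: cvg_trans.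
  apply: near_eq_cvg; apply: nearW => n.
  by rewrite /= normrZ normrM normr_id mulrC.
rewrite (_ : (fun n => _) = (fun n => x.1 n - `|z n| * coef hz n x.2)); last first.
  by apply/funext => n; rewrite xcoef_double.
by rewrite -(subr0 (0 : R)); exact: cvgB.
Qed.

(** Partial sums of even length converge componentwise. One of odd length has a single extra term,
    which tends to 0 because the even-index coefficients do and their basis vectors have norm at
    most 1. *)
Lemma xcoef_cvg x : series (fun k => xcoef x k *: xbasis k) @ \oo --> x.
Proof.
set a := xcoef x; set S := series _.
have SE : S = (fun k => S k./2.*2 + (odd k)%:R *: (a k./2.*2 *: xbasis k./2.*2)).
  apply/funext => k; rewrite -{1}(odd_double_half k).
  by case: (odd k); rewrite ?scale0r ?addr0// scale1r add1n /S seriesSr.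
have S2 : S n.*2 @[n --> \oo] --> x.
  have SE2 n : S n.*2 = (series (fun n => x.1 n *: delta R n) n,
      series (fun n => coef hz n x.2 *: z n) n).
    rewrite /S series_xbasis_double.
    congr (series _ _, series _ _); apply/funext => k; rewrite /a.
      by rewrite xcoef_double xcoef_doubleS subrK.
    by rewrite xcoef_doubleS mulrC mulKf// normr_eq0 basis_neq0.
  apply: cvg_prod; under eq_cvg do rewrite SE2; first exact: series_delta_cvg.
  exact: coef_cvg.
have S0 : (fun k => (odd k)%:R *: (a k./2.*2 *: xbasis k./2.*2)) @ \oo --> (0 : X).
  apply: norm_cvg0; apply: (@squeeze_cvgr _ _ _ _ (cst 0) (fun k => `|a k./2.*2|)).
  - apply: nearW => k; rewrite normr_ge0 /= scalerA normrZ xbasis_double.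
    have d1 : `|(delta R k./2, 0) : X| <= 1.
      rewrite prod_normE/= normr0 ge_max ler01 andbT; apply: cs_norm_le => m.
      by rewrite psum_delta; case: (_ < _)%N; rewrite ?normr1 ?normr0.
    apply: le_trans (ler_wpM2l (normr_ge0 _) d1) _; rewrite mulr1 normrM.
    by case: (odd k); rewrite ?normr1 ?mul1r// normr0 mul0r.
  - exact: cvg_cst.
  - apply/norm_cvg0P; apply: (@cvg_comp _ _ _ half (fun n => a n.*2) _ _ _ half_cvg).
    exact: xcoef_double_cvg.
rewrite SE -(addr0 x); apply: (cvgD _ S0).
exact: (@cvg_comp _ _ _ half (fun n => S n.*2) _ _ _ half_cvg).
Qed.

Lemma xbasis_schauder : schauder_basis xbasis.
Proof.
move=> x; exists (xcoef x); split; first exact: xcoef_cvg.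
move=> a ax; pose S := series (fun k => a k *: xbasis k).
(* Along even lengths the two components are expansions in the unit vectors and in [z], whose
   coefficients are unique; these determine [a]. *)
have S2 : S n.*2 @[n --> \oo] --> x by exact: cvg_comp double_cvg ax.
have c1 : (fun n => a n.*2 + a n.*2.+1) = x.1.
  apply: delta_coef; rewrite (_ : series _ = (fun n => (S n.*2).1)).
    by apply: cvg_comp S2 _; exact: cvg_fst.
  by apply/funext => n; rewrite /S series_xbasis_double.
have c2 : coef hz ^~ x.2 = (fun n => a n.*2.+1 / `|z n|).
  apply: coef_unique; rewrite (_ : series _ = (fun n => (S n.*2).2)).
    by apply: cvg_comp S2 _; exact: cvg_snd.
  by apply/funext => n; rewrite /S series_xbasis_double.
have a2 n : a n.*2.+1 = xcoef x n.*2.+1.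
  rewrite xcoef_doubleS (congr1 (fun f => f n) c2) mulrCA mulfV ?mulr1//.
  by rewrite normr_eq0 basis_neq0.
apply/funext => k; rewrite -(odd_double_half k); case: (odd k); first by rewrite a2.
rewrite add0n xcoef_double -xcoef_doubleS -a2 -(congr1 (fun f => f k./2) c1).
by rewrite addrK.
Qed.

End Construction.

HB.instance Definition _ (R : realType) :=
  GRing.isLinear.Build R (cs R) R *%R (@cs_sum R) (@cs_sum_linear R).

(** * The dual of Z as a complemented space of diagonal operators *)

Section DualEmbedding.
Variables (R : realType) (Z : completeNormedModType R) (z : nat -> Z).
Hypothesis hz : unconditional_basis z.
Local Notation L := (ldiag (xbasis z)).
Local Notation X := (host Z).

Lemma functional_of_in (T : L) :
  (fun x => cs_sum (T ((0, x) : X)).1) \in @bop_pred R Z R.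
Proof.
rewrite inE; split=> [a x y /=|].
  rewrite (_ : ((0, a *: x + y) : X) = a *: ((0, x) : X) + ((0, y) : X)).
    by rewrite linearP/= linearP.
  by congr (_, _); rewrite /= scaler0 addr0.
exists `|T| => x; apply: le_trans (cs_sum_le _) _.
apply: (@le_trans _ _ `|T ((0, x) : X)|); first by rewrite prod_normE le_max lexx.
apply: le_trans (opnorm_bound _ _) _; rewrite -bop_normE; apply: ler_wpM2l => //.
by rewrite prod_normE/= normr0 ge_max normr_ge0 lexx.
Qed.

Definition functional_of (T : L) : dual_space Z := Bop (functional_of_in T).

Lemma functional_of_linear : linear functional_of.
Proof.
move=> a S T; apply: bop_eqP => x.
exact: (linearP (@cs_sum R) a (S ((0, x) : X)).1 (T ((0, x) : X)).1).
Qed.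

Lemma functional_of_le T : `|functional_of T| <= `|T|.
Proof.
apply: opnorm_le_unit => x x1; apply: le_trans (cs_sum_le _) _.
apply: (@le_trans _ _ `|T ((0, x) : X)|); first by rewrite prod_normE le_max lexx.
by apply: opnorm_ub; rewrite prod_normE/= normr0 ge_max ler01.
Qed.

(** The vectors [z n] may have any nonzero norm; dividing by it gives the bounded symbol that [dmul]
    requires. *)
Lemma symbol_le (f : bop Z R) n : `|f (z n) / `|z n| | <= `|f|.
Proof.
rewrite normrM normfV normr_id ler_pdivrMr ?normr_gt0 ?(basis_neq0 hz)//.
exact: opnorm_bound.
Qed.

Lemma diag_seq_in (f : bop Z R) x : (fun n => f (z n) * coef hz n x) \in @cs_pred R.
Proof. by rewrite inE; exact: cvgP (@functional_cvg _ _ _ hz f x). Qed.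

Definition diag_fun (f : bop Z R) (y : X) : X :=
  (Cs (diag_seq_in f y.2), dmul hz (fun n => f (z n) / `|z n|) y.2).

Lemma diag_fun_linear f : linear (diag_fun f).
Proof.
move=> a x y; congr (_, _); last exact: (dmul_linear hz (symbol_le f)).
by apply: val_inj; apply/funext => n /=; rewrite linearP/= mulrDr mulrCA.
Qed.

(** Partial sums of the first component are values of [f] at truncated expansions; the second
    component is a multiplier with symbol bounded by the norm of [f]. The product carries the
    maximum norm. *)
Lemma diag_fun_le f y : `|diag_fun f y| <= `|f| * uncond_norm hz y.2.
Proof.
rewrite prod_normE ge_max; apply/andP; split; last exact: (dmul_norm hz (symbol_le f)).
by apply: cs_norm_le => n; exact: series_functional_le.
Qed.

Lemma diag_fun_in f : diag_fun f \in @bop_pred R X X.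
Proof.
rewrite inE; split; first exact: diag_fun_linear.
have [M M0 HM] := uncond_norm_bounded hz; exists (`|f| * M) => y.
apply: le_trans (diag_fun_le f y) _; rewrite -mulrA; apply: ler_wpM2l => //.
by apply: le_trans (HM _) _; apply: ler_wpM2l => //; rewrite prod_normE le_max lexx orbT.
Qed.

Definition diag_bop f : bop X X := Bop (diag_fun_in f).

Lemma diag_in f : diag_bop f \in ldiag_pred (xbasis z).
Proof.
rewrite inE; exists (fun k => if odd k then f (z k./2) / `|z k./2| else 0) => k.
(* Linearity of [dmul] depends on the bound on the symbol, so this instance is packed locally. *)
pose D : {linear Z -> Z} := HB.pack (dmul hz (fun n => f (z n) / `|z n|))
  (GRing.isLinear.Build _ _ _ _ _ (dmul_linear hz (symbol_le f))).
rewrite /xbasis; case: (odd k) => /=; congr (_, _) => /=.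
- apply: val_inj; apply/funext => n /=; rewrite linearZ/= coef_basis.
  transitivity (f (z k./2) / `|z k./2| * (n == k./2)%:R); last by [].
  by have [->|_] := eqVneq n k./2; rewrite ?mulr1// !mulr0.
- transitivity (D (`|z k./2|^-1 *: z k./2)) => //; rewrite linearZ/=.
  by rewrite dmul_basis !scalerA mulrC.
- by rewrite scale0r; apply: val_inj; apply/funext => n /=; rewrite linear0 mulr0.
- by rewrite scale0r; exact: (linear0 D).
Qed.

Definition diag (f : dual_space Z) : L := Ldiag (diag_in f).

Lemma diag_linear : linear diag.
Proof.
move=> a f g; apply: val_inj; apply: bop_eqP => y /=; congr (_, _) => /=.
  apply: val_inj; apply/funext => n.
  transitivity (a * (f (z n) * coef hz n y.2) + g (z n) * coef hz n y.2) => //.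
  by rewrite mulrA -mulrDl.
apply: cvg_lim => //.
rewrite (_ : (fun N => _) = (fun N =>
    a *: mult hz (fun n => f (z n) / `|z n|) N y.2 +
    mult hz (fun n => g (z n) / `|z n|) N y.2)).
  apply: cvgD; first apply: cvgZr.
    exact: (dmul_cvg (symbol_le f)).
  exact: (dmul_cvg (symbol_le g)).
apply/funext => N; rewrite /mult scaler_sumr -big_split; apply: eq_bigr => n _ /=.
by rewrite [a *: (_ *: _)]scalerA -scalerDl mulrA -mulrDl.
Qed.

Lemma diag_le : exists2 M : R, 0 <= M & forall f, `|diag f| <= M * `|f|.
Proof.
have [M M0 HM] := uncond_norm_bounded hz; exists M => // f.
apply: opnorm_le_unit => y y1; apply: le_trans (diag_fun_le f y) _; rewrite mulrC.
apply: ler_wpM2r => //; apply: le_trans (HM _) _; apply: ler_piMr => //.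
by apply: le_trans y1; rewrite prod_normE le_max lexx orbT.
Qed.

Lemma diagK : cancel diag functional_of.
Proof.
move=> f; apply: bop_eqP => x; apply: cvg_lim => //; exact: functional_cvg.
Qed.

(** A bounded embedding with a bounded left inverse has complemented range: the embedding after the
    left inverse is a projection onto it, and the left inverse restricts to the inverse
    isomorphism. *)
Lemma dual_complemented : isomorphic_to_complemented_subspace (dual_space Z) L.
Proof.
have [M M0 diagM] := diag_le.
have diag_bl : diag \in @bop_pred R (dual_space Z) L.
  by rewrite inE; split; [exact: diag_linear|exists M].
have P_bl : diag \o functional_of \in @bop_pred R L L.
  rewrite inE; split=> [a S T /=|]; first by rewrite functional_of_linear diag_linear.
  exists M => T; apply: le_trans (diagM _) _; apply: ler_wpM2l => //.
  exact: functional_of_le.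
exists (range diag); split.
  exists (Bop P_bl); split=> [T /=|]; first by rewrite diagK.
  apply/seteqP; split=> [_ [T _ <-]|_ [f _ <-]]; first by exists (functional_of T).
  by exists (diag f) => //=; rewrite diagK.
exists (Bop diag_bl), functional_of; split=> //; first exact: diagK.
apply: continuous_subspaceT.
have functional_bl : functional_of \in @bop_pred R L (dual_space Z).
  rewrite inE; split; first exact: functional_of_linear.
  by exists 1 => T; rewrite mul1r; exact: functional_of_le.
exact: (bop_continuous (f := Bop functional_bl)).
Qed.

End DualEmbedding.

Theorem theorem1p2 (R : realType) (Z : completeNormedModType R)
    (z : nat -> Z) (hz : subsymmetric_basis z) :
  exists (X : completeNormedModType R) (e : nat -> X),
    schauder_basis e /\
    isomorphic_to_complemented_subspace (dual_space Z) (ldiag e).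
Proof.
exists (host Z), (xbasis z); split; first exact: xbasis_schauder hz.1.
exact: dual_complemented hz.1.
Qed.
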